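(* Let $G$ be a locally compact, second countable, Hausdorff group, $r_0,R_0>0$ and $\sigma\ge1$. Then $(\mathcal U(r_0,\sigma),G,\tau)$ and $(\mathit{Del}(r_0,R_0,\sigma),G,\tau)$ are topological dynamical systems. Moreover, the group action is Lipschitz continuous, namely for all $g\in G$ and $\Pi,\Xi\in\mathcal U(r_0,\sigma)$, $$d_{wD}(g.\Pi,g.\Xi)\le\big(d_G(e,g)+1\big)\,d_{wD}(\Pi,\Xi).$$
   Context: $G$ is equipped with a fixed adapted metric $d_G$, i.e. a metric that is continuous (so it generates the topology), left-invariant, proper (closed balls are compact) and locally bounded. $B(x,r)$ and $\overline B(x,r)$ denote open and closed balls, and $B(r)=B(e,r)$. A topological dynamical system is a compact metric space together with a continuous left action of $G$. A set $P\subseteq G$ is $r_0$-uniformly discrete if $\sharp(B(x,r_0)\cap P)\le1$ for all $x\in G$, and $R_0$-relatively dense if $G=\bigcup_{x\in P}\overline B(x,R_0)$. A $\sigma$-weight of $P$ is a map $\alpha:P\to[\sigma^{-1},\sigma]$. $\mathcal U(r_0,\sigma)$ is the set of all pairs $(P,\alpha)$ with $P$ $r_0$-uniformly discrete and $\alpha$ a $\sigma$-weight of $P$. $\mathit{Del}(r_0,R_0,\sigma)$ is the set of those $(P,\alpha)\in\mathcal U(r_0,\sigma)$ with $P$ also $R_0$-relatively dense. The action is $\tau(g,(P,\alpha))=g.(P,\alpha)=(gP,\alpha\circ g^{-1})$, where $\alpha\circ g^{-1}$ maps $y\in gP$ to $\alpha(g^{-1}y)$. For $\Pi=(P,\alpha)$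 put $\mu_\Pi=\sum_{x\in P}\alpha(x)\delta_x$ and $\operatorname{supp}(\Pi)=P$. Define $$\delta_{wD}(\Pi,\Xi)=\inf\Big\{\varepsilon>0:\ |\mu_\Pi(B(x,\varepsilon))-\mu_\Xi(B(x,\varepsilon))|<\varepsilon\ \text{ for all }x\in B(\tfrac1\varepsilon)\cap(\operatorname{supp}(\Pi)\cup\operatorname{supp}(\Xi))\Big\},$$ with $\inf\emptyset=\infty$, and the metric $d_{wD}(\Pi,\Xi)=\min\{\frac{r_0}2,\frac{\sigma^{-1}}2,\delta_{wD}(\Pi,\Xi)\}$. *)

(* Defs.v *)
From HB Require Import structures.
From mathcomp Require Import all_boot all_order all_algebra.
From mathcomp Require Import all_classical all_reals all_analysis.

Set Implicit Arguments.
Unset Strict Implicit.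
Unset Printing Implicit Defensive.

Import Order.TTheory GRing.Theory Num.Theory.
Import numFieldNormedType.Exports.

Local Open Scope classical_set_scope.
Local Open Scope ring_scope.

HB.mixin Record TopologicalGroup_isContinuous G of Topological G & Group G := {
  mulg_continuous : continuous (fun x : G * G => (x.1 * x.2)%g) ;
  invg_continuous : continuous (fun x : G => (x^-1)%g)
}.

#[short(type="topologicalGroupType")]
HB.structure Definition TopologicalGroup :=
  {G of Topological G & Group G & TopologicalGroup_isContinuous G}.

Record is_metric_on (R : realType) (S : Type) (X : set S) (d : S -> S -> R) :
    Prop := IsMetricOn {
  metric_on_xx : forall x, X x -> d x x = 0 ;
  metric_on_eq : forall x y, X x -> X y -> d x y = 0 -> x = y ;
  metric_on_sym : forall x y, X x -> X y -> d x y = d y x ;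
  metric_on_triangle : forall y x z, X y -> X x -> X z ->
    d x z <= d x y + d y z
}.

(* The type of points of X. The proof is a parameter so that the type can carry
   the metric (hence the topology) given by d. *)
Definition metric_subspace (R : realType) (S : Type) (X : set S)
  (d : S -> S -> R) (_ : is_metric_on X d) : Type := {x : S | X x}.

Section metric_subspace.
Context (R : realType) (S : Type) (X : set S) (d : S -> S -> R).
Variable hd : is_metric_on X d.
Local Notation T := (metric_subspace hd).

HB.instance Definition _ := gen_eqMixin T.
HB.instance Definition _ := gen_choiceMixin T.

Let dist (x y : T) : R := d (sval x) (sval y).

Let distxx x : dist x x = 0.
Proof. exact: (metric_on_xx hd (svalP x)). Qed.

Let dist_eq x y : dist x y = 0 -> x = y.
Proof.
case: x y => [x Xx] [y Xy] /(metric_on_eq hd Xx Xy) xy.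
by subst y; congr exist; exact: Prop_irrelevance.
Qed.

Let dist_sym x y : dist x y = dist y x.
Proof. exact: (metric_on_sym hd (svalP x) (svalP y)). Qed.

Let dist_triangle y x z : dist x z <= dist x y + dist y z.
Proof. exact: (metric_on_triangle hd (svalP y) (svalP x) (svalP z)). Qed.

HB.instance Definition _ :=
  isMetric.Build R T distxx dist_eq dist_sym dist_triangle.
End metric_subspace.

(* Continuity of the action is joint continuity on G * X. The space X may be
   empty. *)
Definition topological_dynamical_system (R : realType)
    (G : topologicalGroupType) (S : Type) (X : set S) (d : S -> S -> R)
    (act : G -> S -> S) : Prop :=
  exists (hd : is_metric_on X d) (stable : forall g x, X x -> X (act g x)),
    [/\ compact [set: metric_subspace hd],
        forall x, X x -> act 1%g x = x,
        forall g h x, X x -> act (g * h)%g x = act g (act h x) &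
        continuous (fun p : G * metric_subspace hd =>
          exist X (act p.1 (sval p.2)) (stable p.1 (sval p.2) (svalP p.2))
            : metric_subspace hd)].

Section delone.
Context (R : realType) (G : topologicalGroupType).
Variable dG : G -> G -> R.

Definition dball (x : G) (r : R) : set G := [set y | dG x y < r].
Definition cdball (x : G) (r : R) : set G := [set y | dG x y <= r].

Record adapted_metric : Prop := AdaptedMetric {
  adapted_is_metric : is_metric_on [set: G] dG ;
  adapted_continuous : continuous (fun p : G * G => dG p.1 p.2) ;
  adapted_left_invariant : forall g x y, dG (g * x)%g (g * y)%g = dG x y ;
  adapted_proper : forall x r, compact (cdball x r) ;
  adapted_locally_bounded : forall x : G, exists2 V : set G, nbhs x V &
    exists M : R, forall y z, V y -> V z -> dG y z <= M
}.

Definition uniformly_discrete (r0 : R) (P : set G) : Prop :=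
  forall x, (dball x r0 `&` P #<= `I_1)%card.

Definition relatively_dense (R0 : R) (P : set G) : Prop :=
  [set: G] = \bigcup_(x in P) cdball x R0.

(* A pair (P, alpha) with alpha : P -> R; the function alpha is represented by
   its extension by 0 to G, which is_weight enforces, so that equality of pairs
   is equality of weighted sets. *)
Definition weighted_set : Type := (set G * (G -> R))%type.

Definition supp (Pi : weighted_set) : set G := Pi.1.

Definition is_weight (sigma : R) (P : set G) (alpha : G -> R) : Prop :=
  (forall x, P x -> sigma^-1 <= alpha x <= sigma) /\
  (forall x, ~ P x -> alpha x = 0).

Definition UD (r0 sigma : R) : set weighted_set :=
  [set Pi | uniformly_discrete r0 Pi.1 /\ is_weight sigma Pi.1 Pi.2].

Definition Del (r0 R0 sigma : R) : set weighted_set :=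
  [set Pi | UD r0 sigma Pi /\ relatively_dense R0 Pi.1].

Definition tau (g : G) (Pi : weighted_set) : weighted_set :=
  ([set (g * x)%g | x in Pi.1], fun y => Pi.2 (g^-1 * y)%g).

(* (\1_A x)%:E is the mass that the Dirac measure at x gives to A. *)
Definition mu (Pi : weighted_set) (A : set G) : \bar R :=
  \esum_(x in supp Pi) ((Pi.2 x)%:E * (\1_A x)%:E)%E.

Definition delta_wD (Pi Xi : weighted_set) : \bar R :=
  ereal_inf [set eps%:E | eps in [set eps : R | 0 < eps /\
    forall x, (dball 1%g (1 / eps) `&` (supp Pi `|` supp Xi)) x ->
      (`| mu Pi (dball x eps) - mu Xi (dball x eps) | < eps%:E)%E]].

Definition d_wD (r0 sigma : R) (Pi Xi : weighted_set) : R :=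
  fine (Order.min (r0 / 2)%:E (Order.min (sigma^-1 / 2)%:E (delta_wD Pi Xi))).

End delone.

(* Main.v *)
Require Import Defs.
From HB Require Import structures.
From mathcomp Require Import all_boot all_order all_algebra.
From mathcomp Require Import all_classical all_reals all_analysis.
From mathcomp Require Import lra.

Import Order.TTheory GRing.Theory Num.Theory.
Import numFieldNormedType.Exports.

Local Open Scope classical_set_scope.
Local Open Scope ring_scope.

(** The key is a combinatorial reading of [d_wD] below its cap
min(r0/2, sigma^-1/2). At a scale eps under the cap, a ball of radius eps meets
the support of a weighted set in at most one point, whose weight is at least
sigma^-1 > eps. So the masses of eps-balls agree up to eps exactly when every
point of one set in the ball of radius 1/eps about the identity has a partner
in the other set, at distance and weight difference less than eps
([mass_closeP], [shadowed]). Everything else is about partners.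

Since the cap is at most 1/2, the radius 1/eps grows fast as eps decreases:
1/(e1 + e2) + e1 <= 1/e2 as soon as e1 + e2 <= 1. This leaves room to compose
partners, which is the triangle inequality ([shadowed_trans]), and likewise to
absorb the displacement of the window by g, which is the Lipschitz bound
([shadowed_tau]). If all scales are admissible, partners coincide by uniform
discreteness, so that distance 0 means equality ([d_wD_eq]).

Compactness is proved with an ultrafilter F of weighted sets. Its limit is the
set of all points x which, for some weight s and every eps, are F-eventually
eps-close in position and weight to a point of the weighted set. The pairs
(x, s) in play range over the compact sets (closed ball) * [sigma^-1, sigma], and
an ultrafilter decides at each such pair whether it is a limit point; covering
this compact set by finitely many good neighbourhoods turns the pointwise
decisions into convergence in [d_wD] ([ultra_limit_cvg]), and into relative
density of the limit when the sets themselves are relatively dense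
([ultra_limit_Del]).

For joint continuity, the Lipschitz bound moves the weighted set, and it remains
to move g with the weighted set fixed; only the points in a compact ball matter
there, so that g x is close to g0 x uniformly in x ([tau_orbit_near]). *)

(** * Adapted metrics *)

Section adapted_metric_facts.
Context {R : realType} {G : topologicalGroupType} {dG : G -> G -> R}.
Hypothesis dG_adapted : adapted_metric dG.

Lemma adapted_xx x : dG x x = 0.
Proof. exact: (metric_on_xx (adapted_is_metric dG_adapted)). Qed.

Lemma adapted_eq x y : dG x y = 0 -> x = y.
Proof. exact: (metric_on_eq (adapted_is_metric dG_adapted)). Qed.

Lemma adapted_sym x y : dG x y = dG y x.
Proof. exact: (metric_on_sym (adapted_is_metric dG_adapted)). Qed.

Lemma adapted_triangle y x z : dG x z <= dG x y + dG y z.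
Proof. exact: (metric_on_triangle (adapted_is_metric dG_adapted)). Qed.

Lemma adapted_ge0 x y : 0 <= dG x y.
Proof.
by have := adapted_triangle y x x; rewrite adapted_xx (adapted_sym y x); lra.
Qed.

Lemma adapted_small_eq x y : (forall e, 0 < e -> dG x y < e) -> x = y.
Proof.
move=> small; apply: adapted_eq; apply/eqP; rewrite eq_le adapted_ge0 andbT.
by apply/ler_addgt0Pl => e e0; rewrite addr0 ltW// small.
Qed.

(** By left invariance, the distance from x to the identity is the distance from
g x to g. *)
Lemma adapted_translate g x : dG 1%g x <= dG 1%g g + dG 1%g (g * x)%g.
Proof.
rewrite -(adapted_left_invariant dG_adapted g 1%g x) mulg1 (adapted_sym 1%g g).
exact: adapted_triangle.
Qed.

Lemma nbhs_dball x e : 0 < e -> nbhs x (dball dG x e).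
Proof.
move=> e0.
have : (fun y => dG x y) @ x --> dG x x.
  apply: (@continuous_comp _ _ _ (fun y => (x, y)) (fun p => dG p.1 p.2)).
    by apply: cvg_pair; [exact: cvg_cst|exact: cvg_id].
  exact: (adapted_continuous dG_adapted).
rewrite adapted_xx => /cvgr_lt /(_ _ e0); exact.
Qed.

End adapted_metric_facts.

(** * Weighted sets *)

Section uniform_discreteness.
Context {R : realType} {G : topologicalGroupType} {dG : G -> G -> R}.

Lemma uniformly_discreteP r0 (P : set G) : uniformly_discrete dG r0 P <->
  forall x y z, P y -> P z -> dG x y < r0 -> dG x z < r0 -> y = z.
Proof.
split=> [disc x y z Py Pz xy xz|disc x].
  have /card_leP[f] := disc x.
  have Ay : y \in dball dG x r0 `&` P by rewrite inE.
  have Az : z \in dball dG x r0 `&` P by rewrite inE.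
  have /(congr1 val) //: SigSub Ay = SigSub Az.
  apply: (@inj _ _ _ f); rewrite ?inE//.
  have [u v] := (set_valP (f (SigSub Ay)), set_valP (f (SigSub Az))).
  by apply: val_inj; move: u v; rewrite /= !ltnS !leqn0 => /eqP -> /eqP ->.
have [[y [xy Py]]|empty] := pselect ((dball dG x r0 `&` P) !=set0); last first.
  suff -> : dball dG x r0 `&` P = set0 by exact: card_ge0.
  by apply/seteqP; split=> // y ?; case: empty; exists y.
apply: (@card_le_trans _ _ _ [set y]); last by rewrite (card_le_eql card_set1).
by apply: subset_card_le => z [xz Pz]; exact: (disc x).
Qed.

Lemma UD_uniq {r0 sigma Pi x y z} : UD dG r0 sigma Pi ->
  supp Pi y -> supp Pi z -> dG x y < r0 -> dG x z < r0 -> y = z.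
Proof. by move=> [/uniformly_discreteP disc _]; exact: disc. Qed.

Lemma UD_weight {r0 sigma Pi x} : UD dG r0 sigma Pi -> supp Pi x ->
  sigma^-1 <= Pi.2 x <= sigma.
Proof. by move=> [_ [weight _]]; exact: weight. Qed.

Lemma UD_weight0 {r0 sigma Pi x} : UD dG r0 sigma Pi -> ~ supp Pi x ->
  Pi.2 x = 0.
Proof. by move=> [_ [_ weight0]]; exact: weight0. Qed.

End uniform_discreteness.

(** * Partners of points at a given scale *)

Section shadowing.
Context {R : realType} {G : topologicalGroupType} (dG : G -> G -> R).
Hypothesis dG_adapted : adapted_metric dG.

(** This relation is one-sided: it lets the points of Pi be followed in Xi but not
conversely. The constructions below treat the two directions separately. *)
Definition shadowed (eps : R) (Pi Xi : weighted_set R G) : Prop :=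
  forall x, supp Pi x -> dG 1%g x < 1 / eps ->
    exists y, [/\ supp Xi y, dG x y < eps & `|Pi.2 x - Xi.2 y| < eps].

Lemma shadowed_refl eps Pi : 0 < eps -> shadowed eps Pi Pi.
Proof.
by move=> e0 x Px _; exists x; rewrite subrr normr0 adapted_xx.
Qed.

(** A point in the window of radius 1/(e1 + e2) has its first partner in the window
of radius 1/e2, because 1/e2 - 1/(e1 + e2) = e1 / (e2 (e1 + e2)) is at least e1
when e1 + e2 <= 1. *)
Lemma shadowed_trans e1 e2 Pi Xi Theta : 0 < e1 -> 0 < e2 -> e1 + e2 <= 1 ->
  shadowed e1 Pi Xi -> shadowed e2 Xi Theta -> shadowed (e1 + e2) Pi Theta.
Proof.
move=> e1_gt0 e2_gt0 le1 PX XT x Px x_near.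
have lt_inv : 1 / (e1 + e2) + e1 <= 1 / e2.
  rewrite ler_pdivlMr// mulrDl mul1r.
  have s0 : 0 < e1 + e2 by rewrite addr_gt0.
  set t := (e1 + e2)^-1; have ts : t * (e1 + e2) = 1 by rewrite mulVf// gt_eqF.
  have t1 : 1 <= t by rewrite invf_ge1.
  have : 0 <= (t - 1) * e1 by rewrite mulr_ge0 ?subr_ge0// ltW.
  have : 0 <= (t - 1) * e2 by rewrite mulr_ge0 ?subr_ge0// ltW.
  by move: ts; nra.
have [|y [Xy xy wxy]] := PX x Px.
  apply: (lt_le_trans x_near); rewrite !div1r lef_pV2 ?posrE ?addr_gt0//; lra.
have [|z [Tz yz wyz]] := XT y Xy.
  by have := adapted_triangle dG_adapted x 1%g y; lra.
exists z; split=> //.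
  by have := adapted_triangle dG_adapted y x z; lra.
by rewrite (le_lt_trans (ler_distD (Xi.2 y) _ _))// ltrD.
Qed.

Lemma supp_tau g (Pi : weighted_set R G) x : supp (tau g Pi) (g * x)%g <-> supp Pi x.
Proof.
by split=> [[y Py /mulgI <-]//|Px]; exists x.
Qed.

Lemma weight_tau g (Pi : weighted_set R G) x : (tau g Pi).2 (g * x)%g = Pi.2 x.
Proof. by rewrite /= mulKg. Qed.

(** Translation by g preserves distances and weights and moves the window by at
most D = dG 1 g. Enlarging eps to (D + 1) eps shrinks the radius of the window
by D / ((D + 1) eps), which is at least D when (D + 1) eps <= 1. *)
Lemma shadowed_tau eps g Pi Xi : 0 < eps -> (dG 1%g g + 1) * eps <= 1 ->
  shadowed eps Pi Xi ->
  shadowed ((dG 1%g g + 1) * eps) (tau g Pi) (tau g Xi).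
Proof.
have := adapted_ge0 dG_adapted 1%g g; set D := dG 1%g g => D0 e0 le1 PX _ [x Px <-].
move=> gx_near.
have s0 : 0 < (D + 1) * eps by rewrite mulr_gt0//; lra.
have e_le : eps <= (D + 1) * eps by nra.
have lt_inv : D + 1 / ((D + 1) * eps) <= 1 / eps.
  rewrite ler_pdivlMr// mulrDl mul1r.
  set t := (_ * _)^-1; have ts : t * ((D + 1) * eps) = 1 by rewrite mulVf// gt_eqF.
  have t1 : 1 <= t by rewrite invf_ge1.
  have : 0 <= (t - 1) * (D * eps) by rewrite !mulr_ge0 ?subr_ge0// ltW.
  by move: ts; lra.
have [|y [Xy xy wxy]] := PX x Px.
  by have := adapted_translate dG_adapted g x; rewrite -/D; lra.
exists (g * y)%g; split; first exact/supp_tau.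
  by rewrite (adapted_left_invariant dG_adapted); lra.
by rewrite !weight_tau; lra.
Qed.

End shadowing.

(** * The weak distance is a metric *)

Section weak_distance.
Context {R : realType} {G : topologicalGroupType} {dG : G -> G -> R}.
Context {r0 sigma : R}.
Hypothesis dG_adapted : adapted_metric dG.
Hypothesis r0_gt0 : 0 < r0.
Hypothesis sigma_ge1 : 1 <= sigma.
Local Notation UD := (UD dG r0 sigma).
Local Notation d_wD := (d_wD dG r0 sigma).
Local Notation shadowed := (shadowed dG).

Lemma inv_sigma_gt0 : 0 < sigma^-1.
Proof. by rewrite invr_gt0 (lt_le_trans ltr01). Qed.

Lemma inv_sigma_le1 : sigma^-1 <= 1.
Proof. by rewrite invf_le1// (lt_le_trans ltr01). Qed.

(** By uniform discreteness, y is the only support point in the ball, so that the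
sum defining the mass has a single nonzero term. *)
Lemma mu_dball Pi x y eps : UD Pi -> eps <= r0 -> supp Pi y -> dG x y < eps ->
  mu Pi (dball dG x eps) = (Pi.2 y)%:E.
Proof.
move=> UDPi eps_le Py xy; rewrite /mu.
transitivity (\esum_(z in supp Pi) if z \in [set y] then (Pi.2 z)%:E else 0%E).
  apply: eq_esum => z Pz; rewrite indicE; case: ifPn.
    by rewrite inE => ->; rewrite mem_set// mule1.
  move=> zy; rewrite memNset ?mule0// => xz; move: zy => /negP; apply.
  rewrite inE/=.
  exact: (UD_uniq UDPi Pz Py (lt_le_trans xz eps_le) (lt_le_trans xy eps_le)).
rewrite -esum_mkcondr setIC; have -> : [set y] `&` supp Pi = [set y].
  by apply/seteqP; split=> [z []//|z ->].
rewrite esum_set1// lee_fin; have /andP[+ _] := UD_weight UDPi Py.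
by apply: le_trans; rewrite ltW ?inv_sigma_gt0.
Qed.

Lemma mu_dball0 (Pi : weighted_set R G) x eps :
  (forall y, supp Pi y -> ~ dG x y < eps) -> mu Pi (dball dG x eps) = 0%E.
Proof.
move=> far; apply: esum1 => y Py.
by rewrite indicE memNset ?mule0//; exact: far.
Qed.

Definition cap : R := Num.min (r0 / 2) (sigma^-1 / 2).

Lemma cap_gt0 : 0 < cap.
Proof. by rewrite lt_min !divr_gt0 ?inv_sigma_gt0. Qed.

(** Below r0 balls meet a support at most once, below sigma^-1 no support point
goes unnoticed, and below 1/2 the windows of radius 1/eps have room to move. *)
Lemma cap_le : [/\ cap <= r0, cap <= sigma^-1 & cap <= 1 / 2].
Proof.
have := inv_sigma_gt0; have := inv_sigma_le1; have := r0_gt0.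
have c1 : cap <= r0 / 2 by rewrite ge_min lexx.
have c2 : cap <= sigma^-1 / 2 by rewrite ge_min lexx orbT.
by split; lra.
Qed.

Definition mass_close eps (Pi Xi : weighted_set R G) :=
  forall x, (dball dG 1%g (1 / eps) `&` (supp Pi `|` supp Xi)) x ->
    (`| mu Pi (dball dG x eps) - mu Xi (dball dG x eps) | < eps%:E)%E.

(** A support point without a partner would see in the other set a ball of mass 0,
against a mass of at least sigma^-1 > eps of its own. *)
Lemma mass_closeP eps Pi Xi : UD Pi -> UD Xi -> 0 < eps <= cap ->
  mass_close eps Pi Xi <-> shadowed eps Pi Xi /\ shadowed eps Xi Pi.
Proof.
move=> UDPi UDXi /andP[e0 ec].
have [cr cs _] := cap_le.
have er : eps <= r0 by lra.
have es : eps <= sigma^-1 by lra.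
have weight_big Th x : UD Th -> supp Th x -> (`|(Th.2 x)%:E| < eps%:E)%E -> False.
  move=> UDTh Tx; have := UD_weight UDTh Tx => /andP[+ _].
  by rewrite lte_fin => w1 /(le_lt_trans (ler_norm _)); lra.
split=> [close|[PX XP] x [x_near [Px|Xx]]].
- split=> x Px x_near.
    have := close x (conj x_near (or_introl Px)).
    rewrite (mu_dball _ _ _ _ UDPi er Px) ?adapted_xx//.
    have [[y [Xy xy]]|none] := pselect (exists y, supp Xi y /\ dG x y < eps).
      by rewrite (mu_dball _ _ _ _ UDXi er Xy xy) => wxy; exists y.
    rewrite mu_dball0 ?sube0; first by move=> /(weight_big _ _ UDPi Px).
    by move=> y Xy xy; apply: none; exists y.
  have := close x (conj x_near (or_intror Px)).
  rewrite (mu_dball _ _ _ _ UDXi er Px) ?adapted_xx//.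
  have [[y [Xy xy]]|none] := pselect (exists y, supp Pi y /\ dG x y < eps).
    rewrite (mu_dball _ _ _ _ UDPi er Xy xy) => wxy; exists y; split=> //.
    by rewrite distrC.
  rewrite mu_dball0 ?sub0e ?abseN; first by move=> /(weight_big _ _ UDXi Px).
  by move=> y Xy xy; apply: none; exists y.
- have [y [Xy xy wxy]] := PX x Px x_near.
  by rewrite (mu_dball _ _ _ _ UDPi er Px) ?adapted_xx// (mu_dball _ _ _ _ UDXi er Xy xy).
- have [y [Py xy wxy]] := XP x Xx x_near.
  rewrite (mu_dball _ _ _ _ UDXi er Xx) ?adapted_xx// (mu_dball _ _ _ _ UDPi er Py xy).
  by rewrite /= lte_fin distrC.
Qed.

(** The minimum in [d_wD] is taken in the extended reals, where the infimum may be
+oo; it is always a finite number, since the infimum is nonnegative and the cap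
is finite. *)
Lemma EFin_d_wD Pi Xi :
  (d_wD Pi Xi)%:E = Order.min cap%:E (delta_wD dG Pi Xi).
Proof.
rewrite /Defs.d_wD minA -EFin_min fineK// fin_numE.
have : (0 <= delta_wD dG Pi Xi)%E.
  by apply: le_ereal_inf_tmp => _ [e [e0 _] <-]; rewrite lee_fin ltW.
rewrite -/cap; case: (delta_wD _ _ _) => [d| |]//= _.
  by rewrite -EFin_min.
by rewrite min_l ?leey.
Qed.

Lemma d_wD_le_cap Pi Xi : d_wD Pi Xi <= cap.
Proof. by rewrite -lee_fin EFin_d_wD ge_min lexx. Qed.

Lemma d_wD_ge0 Pi Xi : 0 <= d_wD Pi Xi.
Proof.
rewrite -lee_fin EFin_d_wD le_min lee_fin (ltW cap_gt0)/=.
by apply: le_ereal_inf_tmp => _ [e [e0 _] <-]; rewrite lee_fin ltW.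
Qed.

(** Together with [d_wD_lt], this reduces every inequality about [d_wD] to one
about [shadowed]. The bound needs checking only at scales below the cap, as the
distance never exceeds the cap. *)
Lemma d_wD_le Pi Xi eps : UD Pi -> UD Xi -> 0 < eps ->
  (eps < cap -> shadowed eps Pi Xi /\ shadowed eps Xi Pi) ->
  d_wD Pi Xi <= eps.
Proof.
move=> UDPi UDXi e0 close.
have [/(le_trans (d_wD_le_cap _ _))//|ec] := lerP cap eps.
rewrite -lee_fin EFin_d_wD ge_min; apply/orP; right.
apply: ereal_inf_lbound; exists eps => //; split=> //.
by apply/mass_closeP => //; [rewrite e0 ltW|exact: close].
Qed.

Lemma d_wD_lt {Pi Xi c} : UD Pi -> UD Xi -> d_wD Pi Xi < c -> c <= cap ->
  exists eps, [/\ 0 < eps, eps < c, shadowed eps Pi Xi & shadowed eps Xi Pi].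
Proof.
move=> UDPi UDXi; rewrite -lte_fin EFin_d_wD gt_min lte_fin => /orP[|]; first by lra.
move=> /ereal_inf_lt[_ [e [e0 /mass_closeP close] <-]]; rewrite lte_fin => ec ccap.
have [//|//||PX XP] := close; first by rewrite e0; lra.
by exists e.
Qed.

Lemma d_wDxx Pi : UD Pi -> d_wD Pi Pi = 0.
Proof.
move=> UDPi; apply/eqP; rewrite eq_le d_wD_ge0 andbT.
apply/ler_addgt0Pl => e e0; rewrite addr0; apply: d_wD_le => // _.
by split; exact: shadowed_refl.
Qed.

Lemma d_wD_sym Pi Xi : UD Pi -> UD Xi -> d_wD Pi Xi = d_wD Xi Pi.
Proof.
have half Th Th' : UD Th -> UD Th' -> d_wD Th Th' <= d_wD Th' Th.
  move=> UDT UDT'; rewrite leNgt; apply/negP => /(d_wD_lt UDT' UDT).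
  move=> /(_ (d_wD_le_cap _ _))[e [e0 elt T'T TT']].
  by have := d_wD_le _ _ _ UDT UDT' e0 (fun _ => conj TT' T'T); lra.
by move=> UDPi UDXi; apply/eqP; rewrite eq_le !half.
Qed.

(** If the inequality failed, both distances on the right would be below the cap,
hence witnessed by scales e1 and e2 so close to them that e1 + e2 < d. *)
Lemma d_wD_triangle Xi Pi Theta : UD Xi -> UD Pi -> UD Theta ->
  d_wD Pi Theta <= d_wD Pi Xi + d_wD Xi Theta.
Proof.
move=> UDX UDP UDT; rewrite leNgt; apply/negP => lt.
have := d_wD_le_cap Pi Theta; have [_ _ cap1] := cap_le.
set d := d_wD Pi Theta in lt *; move=> dcap.
(* The gap is shared equally between the two scales. *)
pose eta := (d - (d_wD Pi Xi + d_wD Xi Theta)) / 2.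
have eta0 : 0 < eta by rewrite /eta; lra.
have [g1 g2] := (d_wD_ge0 Pi Xi, d_wD_ge0 Xi Theta).
have [||e1 [e10 e1lt PX XP]] := @d_wD_lt Pi Xi (d_wD Pi Xi + eta) UDP UDX.
- by lra.
- by rewrite /eta; lra.
have [||e2 [e20 e2lt XT TX]] := @d_wD_lt Xi Theta (d_wD Xi Theta + eta) UDX UDT.
- by lra.
- by rewrite /eta; lra.
suff : d <= e1 + e2 by move: e1lt e2lt; rewrite /eta; lra.
apply: d_wD_le => // [|sum_lt]; first by rewrite addr_gt0.
split; first by apply: (shadowed_trans dG dG_adapted) PX XT => //; lra.
by rewrite addrC; apply: (shadowed_trans dG dG_adapted) TX XP => //; lra.
Qed.

(** All partners of x at scales below r0 lie in one ball of radius r0, so they are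
the same point y, which is then at distance 0 from x. *)
Lemma shadowed_subset Pi Xi : UD Pi -> UD Xi ->
  (forall c, 0 < c -> exists eps, [/\ 0 < eps, eps < c & shadowed eps Pi Xi]) ->
  forall x, supp Pi x -> supp Xi x /\ Pi.2 x = Xi.2 x.
Proof.
move=> UDP UDX close x Px.
(* At the scale 1/(dG 1 x + 1) the window contains x; smaller scales keep it
   there. *)
have near_x e : 0 < e ->
    exists y, [/\ supp Xi y, dG x y < e & `|Pi.2 x - Xi.2 y| < e].
  move=> e0; have D0 := adapted_ge0 dG_adapted 1%g x.
  have D1 : 0 < (dG 1%g x + 1)^-1 by rewrite invr_gt0; lra.
  have [|eps [eps0 lt PX]] := close (Num.min e (dG 1%g x + 1)^-1).
    by rewrite lt_min e0.
  move: lt; rewrite lt_min => /andP[lte ltD].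
  have [|y [Xy xy wxy]] := PX x Px.
    rewrite div1r; suff : dG 1%g x + 1 < eps^-1 by lra.
    by rewrite -ltf_pV2 ?posrE ?invrK ?invr_gt0//; lra.
  by exists y; split=> //; lra.
have [y [Xy xy _]] := near_x r0 r0_gt0.
have same e : 0 < e -> dG x y < e /\ `|Pi.2 x - Xi.2 y| < e.
  move=> e0; have [|z [Xz]] := near_x (Num.min e r0); first by rewrite lt_min e0.
  rewrite !lt_min => /andP[xz xz'] /andP[wxz _].
  by rewrite (UD_uniq UDX Xy Xz xy xz').
have exy : x = y by apply: (adapted_small_eq dG_adapted) => e /same[].
move: Xy same; rewrite -exy => Xx same; split=> //.
apply/eqP; rewrite -subr_eq0 -normr_eq0 eq_le normr_ge0 andbT.
by apply/ler_addgt0Pl => e e0; rewrite addr0 ltW//; case: (same e e0).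
Qed.

Lemma d_wD_eq Pi Xi : UD Pi -> UD Xi -> d_wD Pi Xi = 0 -> Pi = Xi.
Proof.
move=> UDP UDX d0.
have close c : 0 < c ->
    exists eps, [/\ 0 < eps, eps < c, shadowed eps Pi Xi & shadowed eps Xi Pi].
  move=> c0; have [||e [e0 elt PX XP]] := @d_wD_lt Pi Xi (Num.min c cap) UDP UDX.
  - by rewrite d0 lt_min c0 cap_gt0.
  - by rewrite ge_min lexx orbT.
  by exists e; split=> //; move: elt; rewrite lt_min => /andP[].
have PX : forall x, supp Pi x -> supp Xi x /\ Pi.2 x = Xi.2 x.
  by apply: shadowed_subset => // c /close[e [? ? ? _]]; exists e.
have XP : forall x, supp Xi x -> supp Pi x /\ Xi.2 x = Pi.2 x.
  by apply: shadowed_subset => // c /close[e [? ? _ ?]]; exists e.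
rewrite (surjective_pairing Pi) (surjective_pairing Xi); congr pair.
  by apply/seteqP; split=> x => [/PX[]|/XP[]].
apply/funext => x; have [/PX[]//|nPx] := pselect (supp Pi x).
rewrite (UD_weight0 UDP nPx) (UD_weight0 UDX)// => Xx.
by apply: nPx; case: (XP x Xx).
Qed.

Lemma d_wD_metric (X : set (weighted_set R G)) : X `<=` UD -> is_metric_on X d_wD.
Proof.
move=> XU; split=> [x /XU|x y /XU Ux /XU Uy|x y /XU Ux /XU Uy|y x z /XU Uy /XU Ux /XU Uz].
- exact: d_wDxx.
- exact: d_wD_eq.
- exact: d_wD_sym.
- exact: d_wD_triangle.
Qed.

(** * Translation of weighted sets *)

Lemma UD_tau g Pi : UD Pi -> UD (tau g Pi).
Proof.
move=> UDP; split.
  apply/uniformly_discreteP => x _ _ [y Py <-] [z Pz <-].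
  rewrite -{1 2}(mulVKg g x) !(adapted_left_invariant dG_adapted) => xy xz.
  by rewrite (UD_uniq UDP Py Pz xy xz).
split=> [_ [x Px <-]|x nPx].
  by rewrite weight_tau; exact: UD_weight UDP Px.
rewrite /= (UD_weight0 UDP)// => Px; apply: nPx.
by exists (g^-1 * x)%g; rewrite ?mulVKg.
Qed.

Lemma Del_tau R0 g Pi : Del dG r0 R0 sigma Pi -> Del dG r0 R0 sigma (tau g Pi).
Proof.
move=> [UDP dense]; split; first exact: UD_tau.
apply/seteqP; split=> // y _.
have : [set: G] (g^-1 * y)%g by [].
rewrite dense => -[x Px xy]; exists (g * x)%g; first exact/supp_tau.
by rewrite /cdball/= -(mulVKg g y) (adapted_left_invariant dG_adapted).
Qed.

(** A scale eps for the distance of Pi and Xi yields the scale (dG 1 g + 1) eps for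
their translates, by [shadowed_tau]. Its hypothesis (dG 1 g + 1) eps <= 1 holds
when this scale is below the cap; otherwise the bound exceeds the cap. *)
Lemma tau_lipschitz g Pi Xi : UD Pi -> UD Xi ->
  d_wD (tau g Pi) (tau g Xi) <= (dG 1%g g + 1) * d_wD Pi Xi.
Proof.
move=> UDP UDX; rewrite leNgt; apply/negP.
have [_ _ cap1] := cap_le.
have := d_wD_le_cap (tau g Pi) (tau g Xi).
set d := d_wD (tau g Pi) (tau g Xi) => dcap lt.
have D0 := adapted_ge0 dG_adapted 1%g g.
have D1 : 0 < dG 1%g g + 1 by lra.
have d0 : 0 <= d by exact: d_wD_ge0.
have [||e [e0 elt PX XP]] := @d_wD_lt Pi Xi (d / (dG 1%g g + 1)) UDP UDX.
- by rewrite ltr_pdivlMr// mulrC.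
- by rewrite ler_pdivrMr//; have := cap_gt0; nra.
have lt_d : (dG 1%g g + 1) * e < d by rewrite mulrC -ltr_pdivlMr.
have le1 : (dG 1%g g + 1) * e <= 1 by lra.
suff : d <= (dG 1%g g + 1) * e by lra.
apply: d_wD_le; [exact: UD_tau|exact: UD_tau|exact: mulr_gt0|move=> _].
by split; exact: shadowed_tau.
Qed.

(** The partner of g x is g0 x. If one of them lies in the window of radius 1/eps
and g is within 1 of g0, then x lies in a fixed closed ball, which is compact; so
the continuous function (g, x) |-> dG (g x) (g0 x), zero at g = g0, is small
uniformly on that ball for g near g0. *)
Lemma tau_orbit_near Pi g0 eps : 0 < eps ->
  \forall g \near g0, shadowed eps (tau g Pi) (tau g0 Pi) /\
                      shadowed eps (tau g0 Pi) (tau g Pi).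
Proof.
move=> e0.
have /compact_near_coveringP tube :
  compact (cdball dG 1%g (dG 1%g g0 + 1 + 1 / eps)) by exact: adapted_proper.
have moved : \forall g \near g0,
    cdball dG 1%g (dG 1%g g0 + 1 + 1 / eps) `<=`
    [set x | dG (g * x)%g (g0 * x)%g < eps].
  apply: tube => x _.
  have /(_ (x, g0)) : continuous (fun p : G * G => dG (p.2 * p.1)%g (g0 * p.1)%g).
    move=> p; have mul_cont (u v : G) := @mulg_continuous G (u, v).
    apply: (@continuous2_cvg _ _ _ _ _ _ _ _ dG).
    - exact: (@adapted_continuous _ _ _ dG_adapted (_, _)).
    - apply: (@continuous2_cvg _ _ _ _ _ _ _ _ (fun u v : G => (u * v)%g)).
      + exact: mul_cont.
      + exact: cvg_snd.
      + exact: cvg_fst.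
    - apply: (@continuous2_cvg _ _ _ _ _ _ _ _ (fun u v : G => (u * v)%g)).
      + exact: mul_cont.
      + exact: cvg_cst.
      + exact: cvg_fst.
  by move=> /cvgr_lt /(_ eps) /=; rewrite adapted_xx//; exact.
near=> g.
have near_g0 : dG g0 g < 1 by near: g; exact: nbhs_dball.
have moved_g : cdball dG 1%g (dG 1%g g0 + 1 + 1 / eps) `<=`
    [set x | dG (g * x)%g (g0 * x)%g < eps] by near: g.
have D_g : dG 1%g g <= dG 1%g g0 + 1.
  by have := adapted_triangle dG_adapted g0 1%g g; lra.
split=> _ [x Px <-] x_near; eexists; (split; first by apply/supp_tau; exact: Px).
- apply: moved_g; rewrite /cdball/=.
  by have := adapted_translate dG_adapted g x; lra.
- by rewrite !weight_tau subrr normr0.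
- rewrite (adapted_sym dG_adapted); apply: moved_g; rewrite /cdball/=.
  by have := adapted_translate dG_adapted g0 x; lra.
- by rewrite !weight_tau subrr normr0.
Unshelve. all: by end_near. Qed.

(** * Limits of ultrafilters of weighted sets *)

Section ultra_limit.
Context (F : set_system (weighted_set R G)) (FF : ProperFilter F).
(* Maximality, as a dichotomy: in this form it passes to all image filters. *)
Hypothesis F_ultra : forall A, F A \/ F (~` A).
Hypothesis F_UD : F UD.

Definition near_point (eps : R) (x : G) (s : R) : set (weighted_set R G) :=
  [set Pi | exists p, [/\ supp Pi p, dG x p < eps & `|s - Pi.2 p| < eps]].

Definition limit_point (x : G) (s : R) : Prop :=
  forall eps, 0 < eps -> F (near_point eps x s).

(** The default value 0 of [xget] makes the weight vanish off the support. Where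
some weight exists, it is unique by [limit_point_inj]. *)
Definition ultra_limit : weighted_set R G :=
  ([set x | exists s, limit_point x s], fun x => xget 0 [set s | limit_point x s]).

Lemma ultra_limit_point x : supp ultra_limit x ->
  limit_point x (ultra_limit.2 x).
Proof. exact: xgetPex. Qed.

(** Two limit points are approximated simultaneously by points of one and the same
weighted set, from which uniform discreteness and bounds on weights are then
inherited in the limit. *)
Lemma limit_point_pair {x y s t eps} : limit_point x s -> limit_point y t ->
  0 < eps -> exists Pi p q, [/\ UD Pi, supp Pi p & supp Pi q] /\
  [/\ dG x p < eps, `|s - Pi.2 p| < eps, dG y q < eps & `|t - Pi.2 q| < eps].
Proof.
move=> xs yt e0.
have [Pi [[UDPi [p [Pp xp sp]]] [q [Pq yq tq]]]] :=
  filter_ex (filterI (filterI F_UD (xs _ e0)) (yt _ e0)).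
by exists Pi, p, q.
Qed.

Lemma limit_point_inj x s t : limit_point x s -> limit_point x t -> s = t.
Proof.
move=> xs xt; apply/eqP; rewrite -subr_eq0 -normr_eq0 eq_le normr_ge0 andbT.
apply/ler_addgt0Pl => e e0; rewrite addr0.
have m0 : 0 < Num.min (e / 2) r0 by rewrite lt_min divr_gt0.
have [Pi [p [q [[UDP Pp Pq]]]]] := limit_point_pair xs xt m0.
rewrite !lt_min => -[/andP[_ xp] /andP[sp _] /andP[_ xq] /andP[tq _]].
move: sp tq; rewrite (UD_uniq UDP Pp Pq xp xq) => sp tq.
by have := ler_distD (Pi.2 q) s t; rewrite (distrC (Pi.2 q) t); lra.
Qed.

Lemma ultra_limit_UD : UD ultra_limit.
Proof.
split.
  apply/uniformly_discreteP => x y z [s ys] [t zt] xy xz.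
  apply: (adapted_small_eq dG_adapted) => e e0.
  have m0 : 0 < Num.min (e / 2) (Num.min (r0 - dG x y) (r0 - dG x z)).
    by rewrite !lt_min divr_gt0// !subr_gt0 xy.
  have [Pi [p [q [[UDP Pp Pq]]]]] := limit_point_pair ys zt m0.
  rewrite !lt_min => -[/and3P[yp yp' _] _ /and3P[zq _ zq'] _].
  have pq : p = q.
    apply: (@UD_uniq _ _ _ _ _ _ x _ _ UDP Pp Pq).
      by have := adapted_triangle dG_adapted y x p; lra.
    by have := adapted_triangle dG_adapted z x q; lra.
  move: yp; rewrite pq => yp; have := adapted_triangle dG_adapted q y z.
  by rewrite (adapted_sym dG_adapted q z); lra.
split=> [x Px|x nPx]; last first.
  by apply: xgetPN => s xs; apply: nPx; exists s.
have xs := ultra_limit_point x Px.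
have close e : 0 < e -> exists2 w, sigma^-1 <= w <= sigma & `|ultra_limit.2 x - w| < e.
  move=> e0; have [Pi [p [_ [[UDP Pp _] [_ wp _ _]]]]] := limit_point_pair xs xs e0.
  by exists (Pi.2 p) => //; exact: UD_weight UDP Pp.
by apply/andP; split; apply/ler_addgt0Pl => e /close[w /andP[w1 w2]];
  rewrite ltr_norml => /andP[]; lra.
Qed.

(** An ultrafilter does not merely fail to produce points near a non-limit pair: it
eventually forbids them, and hence also at the neighbouring pairs. *)
Lemma no_limit_point_near x s : ~ limit_point x s ->
  \forall y \near (x, s) & Pi \near F, ~ (supp Pi y.1 /\ Pi.2 y.1 = y.2).
Proof.
move=> /existsNP[e /not_implyP[e0 nF]].
have {}nF := or_ind (fun FA => False_ind _ (nF FA)) id (F_ultra _).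
exists (dball dG x e `*` ball s e, ~` near_point e x s) => /=; [split; last exact: nF|].
  exists (dball dG x e, ball s e) => //.
  by split; [exact: nbhs_dball|exact: nbhsx_ballx].
move=> [[y t] Pi] /= [[xy st] nPi] [Py wy]; apply: nPi; exists y; split=> //.
by rewrite wy.
Qed.

Lemma limit_points_compact x r :
  compact (cdball dG x r `*` `[sigma^-1, sigma]%classic : set (G * R)).
Proof.
by apply: compact_setX; [exact: adapted_proper|exact: segment_compact].
Qed.

(** At each pair (x, s) of the compact set of possible points and weights, either
(x, s) is a limit point, and serves as a partner for all nearby pairs, or
eventually no point of Pi sits near (x, s). *)
Lemma ultra_limit_shadows eps : 0 < eps ->
  \forall Pi \near F, shadowed eps Pi ultra_limit.
Proof.
move=> e0.
have /compact_near_coveringP tube := limit_points_compact 1%g (1 / eps).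
have : \forall Pi \near F, cdball dG 1%g (1 / eps) `*` `[sigma^-1, sigma]%classic `<=`
    [set y | supp Pi y.1 -> Pi.2 y.1 = y.2 ->
      exists z, [/\ supp ultra_limit z, dG y.1 z < eps & `|y.2 - ultra_limit.2 z| < eps]].
  apply: tube => -[x s] _; have [xs|nxs] := pselect (limit_point x s); last first.
    have := no_limit_point_near _ _ nxs; apply: filterS => -[y Pi] /= H Py wy.
    by case: H.
  have Lx : supp ultra_limit x by exists s.
  have ws := limit_point_inj _ _ _ (ultra_limit_point _ Lx) xs.
  exists (dball dG x eps `*` ball s eps, setT) => /=.
    split; last exact: filterT.
    exists (dball dG x eps, ball s eps) => //.
    by split; [exact: nbhs_dball|exact: nbhsx_ballx].
  move=> [[y t] Pi] /= [[xy st] _] _ _; exists x; split=> //.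
    by rewrite (adapted_sym dG_adapted).
  by have : `|t - ultra_limit.2 x| < eps by rewrite ws distrC.
apply: filterS2 F_UD => Pi UDP close x Px x_near.
by apply: (close (x, Pi.2 x)) => //; split;
  [exact: ltW|rewrite /= in_itv; exact: UD_weight UDP Px].
Qed.

(** A limit point y eventually has a partner. To make this uniform in y, note that
any ball of radius r0 contains at most one limit point, and that finitely many
such balls cover the window. *)
Lemma ultra_limit_shadowed eps : 0 < eps ->
  \forall Pi \near F, shadowed eps ultra_limit Pi.
Proof.
move=> e0.
have /compact_near_coveringP tube :
  compact (cdball dG 1%g (1 / eps)) by exact: adapted_proper.
suff : \forall Pi \near F, cdball dG 1%g (1 / eps) `<=` [set y | supp ultra_limit y ->
    exists z, [/\ supp Pi z, dG y z < eps & `|ultra_limit.2 y - Pi.2 z| < eps]].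
  by apply: filterS => Pi close x Lx x_near; apply: close Lx; exact: ltW.
apply: tube => x _.
have [[y [xy Ly]]|none] := pselect (exists y, dG x y < r0 /\ supp ultra_limit y).
  exists (dball dG x r0, near_point eps y (ultra_limit.2 y)) => /=.
    by split; [exact: nbhs_dball|exact: (ultra_limit_point _ Ly _ e0)].
  move=> [z Pi] /= [xz [p [Pp yp wp]]] Lz.
  by exists p; rewrite (UD_uniq ultra_limit_UD Lz Ly xz xy).
exists (dball dG x r0, setT) => /=.
  by split; [exact: nbhs_dball|exact: filterT].
by move=> [z Pi] /= [xz _] Lz; case: none; exists z.
Qed.

Lemma ultra_limit_cvg c : 0 < c -> \forall Pi \near F, d_wD ultra_limit Pi < c.
Proof.
move=> c0; have c20 : 0 < c / 2 by rewrite divr_gt0.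
apply: filterS3 F_UD (ultra_limit_shadowed _ c20) (ultra_limit_shadows _ c20).
move=> Pi UDP LP PL.
by rewrite (le_lt_trans (d_wD_le _ _ _ ultra_limit_UD UDP c20 _))//; lra.
Qed.

(** If no limit point were in the closed R0-ball about y, then by compactness the
weighted sets would eventually have no point in this ball at all. *)
Lemma ultra_limit_Del R0 : F (Del dG r0 R0 sigma) -> Del dG r0 R0 sigma ultra_limit.
Proof.
move=> F_Del; split; first exact: ultra_limit_UD.
apply/seteqP; split=> // y _; apply: contrapT => far.
have /compact_near_coveringP tube := limit_points_compact y R0.
have : \forall Pi \near F, cdball dG y R0 `*` `[sigma^-1, sigma]%classic `<=`
    [set z | ~ (supp Pi z.1 /\ Pi.2 z.1 = z.2)].
  apply: tube => -[x s] [/= xy _]; apply: no_limit_point_near => xs; apply: far.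
  by exists x; [exists s|rewrite /cdball/= (adapted_sym dG_adapted)].
move=> /(filterI F_Del)/filter_ex[Pi [[UDP dense] far_Pi]].
have : [set: G] y by [].
rewrite dense => -[x Px xy]; apply: (far_Pi (x, Pi.2 x)) => //.
split; first by rewrite /cdball/= (adapted_sym dG_adapted).
by rewrite /= in_itv; exact: UD_weight UDP Px.
Qed.

End ultra_limit.

(** * Dynamical systems of weighted sets *)

Lemma weighted_sets_dynamical_system (X : set (weighted_set R G)) :
  X `<=` UD -> (forall g Pi, X Pi -> X (tau g Pi)) ->
  (forall F, ProperFilter F -> (forall A, F A \/ F (~` A)) -> F X ->
    X (ultra_limit F)) ->
  topological_dynamical_system X d_wD (@tau R G).
Proof.
move=> XU stable closed; exists (d_wD_metric X XU), stable; split.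
- rewrite compact_ultra => F UF _.
  (* The limit is formed in the ambient type, along the image ultrafilter. *)
  pose H : set_system (weighted_set R G) := sval @ F.
  have H_ultra A : H A \/ H (~` A) by exact: (@in_ultra_setVsetC _ F (sval @^-1` A)).
  have HX : H X.
    suff : F (sval @^-1` X) by [].
    have -> : sval @^-1` X = [set: metric_subspace (d_wD_metric X XU)].
      by apply/seteqP; split=> // x _; exact: svalP.
    exact: filterT.
  have HU : H UD by apply: filterS HX.
  exists (exist _ _ (closed H _ H_ultra HX)); split=> //.
  apply/cvg_ballP => e e0; rewrite near_map.
  exact: (ultra_limit_cvg H _ H_ultra HU e e0).
- move=> [P a] _; rewrite /tau/=; congr pair.
    by apply/seteqP; split=> [_ [x Px <-]|x Px]; [rewrite mul1g|exists x; rewrite ?mul1g].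
  by apply/funext => x; rewrite invg1 mul1g.
- move=> g h [P a] _; rewrite /tau/=; congr pair.
    apply/seteqP; split=> [_ [x Px <-]|_ [_ [x Px <-] <-]].
      by exists (h * x)%g; [exists x|rewrite mulgA].
    by exists x; rewrite ?mulgA.
  by apply/funext => x; rewrite invgM mulgA.
- move=> [g0 [Pi0 XPi0]]; apply/cvg_ballP => e e0.
  have UDPi0 := XU _ XPi0.
  have D0 := adapted_ge0 dG_adapted 1%g g0.
  have D1 : 0 < dG 1%g g0 + 2 by lra.
  (* Half of e is for moving g0 to g at Pi0, half for moving Pi0 to Pi under g,
     whose Lipschitz constant dG 1 g + 1 is at most dG 1 g0 + 2. *)
  pose x0 : metric_subspace (d_wD_metric X XU) := exist X Pi0 XPi0.
  have near_fst (A : set G) : nbhs g0 A -> \forall p \near (g0, x0), A p.1.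
    exact: (@cvg_fst _ _ (nbhs g0) (nbhs x0)).
  have near_snd (A : set (metric_subspace (d_wD_metric X XU))) :
      nbhs x0 A -> \forall p \near (g0, x0), A p.2.
    exact: (@cvg_snd _ _ (nbhs g0) (nbhs x0)).
  have e20 : 0 < e / 2 by rewrite divr_gt0.
  near=> p.
  have orbit : d_wD (tau g0 Pi0) (tau p.1 Pi0) <= e / 2.
    apply: d_wD_le => //; [exact: UD_tau|exact: UD_tau|move=> _].
    suff [] : shadowed (e / 2) (tau p.1 Pi0) (tau g0 Pi0) /\
              shadowed (e / 2) (tau g0 Pi0) (tau p.1 Pi0) by [].
    by near: p; exact: (near_fst _ (tau_orbit_near Pi0 g0 _ e20)).
  have g_close : dG g0 p.1 < 1.
    by near: p; exact: (near_fst _ (nbhs_dball dG_adapted g0 _ ltr01)).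
  have Pi_close : d_wD Pi0 (sval p.2) < e / 2 / (dG 1%g g0 + 2).
    near: p; apply: (near_snd _ (nbhsx_ballx x0 (e / 2 / (dG 1%g g0 + 2)) _)).
    by rewrite !divr_gt0.
  have UDp := XU _ (svalP p.2).
  rewrite /ball/=.
  apply: (le_lt_trans (d_wD_triangle (tau p.1 Pi0) _ _ _ _ _)); try exact: UD_tau.
  rewrite [ltRHS](splitr e) ler_ltD//.
  apply: (le_lt_trans (tau_lipschitz p.1 _ _ UDPi0 UDp)).
  have p_bound : dG 1%g p.1 + 1 <= dG 1%g g0 + 2.
    by have := adapted_triangle dG_adapted g0 1%g p.1; lra.
  rewrite (le_lt_trans (ler_wpM2r (d_wD_ge0 _ _) p_bound))//.
  by rewrite mulrC -ltr_pdivlMr.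
Unshelve. all: by end_near. Qed.

End weak_distance.

Theorem proposition3p16 (R : realType) (G : topologicalGroupType)
    (G_locally_compact : locally_compact [set: G])
    (G_second_countable : @second_countable G)
    (G_hausdorff : hausdorff_space G)
    (dG : G -> G -> R) (dG_adapted : adapted_metric dG)
    (r0 R0 sigma : R) (r0_gt0 : 0 < r0) (R0_gt0 : 0 < R0)
    (sigma_ge1 : 1 <= sigma) :
  [/\ topological_dynamical_system
        (UD dG r0 sigma) (d_wD dG r0 sigma) (@tau R G),
      topological_dynamical_system
        (Del dG r0 R0 sigma) (d_wD dG r0 sigma) (@tau R G) &
      forall (g : G) (Pi Xi : weighted_set R G),
        UD dG r0 sigma Pi -> UD dG r0 sigma Xi ->
        d_wD dG r0 sigma (tau g Pi) (tau g Xi)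
          <= (dG 1%g g + 1) * d_wD dG r0 sigma Pi Xi].
Proof.
split.
- apply: weighted_sets_dynamical_system => //; first by move=> g Pi; exact: UD_tau.
  by move=> F FF F_ultra F_UD; exact: ultra_limit_UD.
- apply: weighted_sets_dynamical_system => // [Pi []//|g Pi|F FF F_ultra F_Del].
    exact: Del_tau.
  by apply: ultra_limit_Del => //; apply: filterS F_Del => Pi [].
- by move=> g Pi Xi; exact: tau_lipschitz.
Qed.
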